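(* Let $\alpha>0$, let $A$ be an $n\times n$ nonsingular $M$-matrix, $R=A^{-1}$, and let $Z=(Z_1,\ldots,Z_n)=Z_{\alpha,\overline B}$ be the associated $\mathbb{N}^n$-valued random variable. Then for every integer $m\ge1$ and every $1\le p\le n$, $$E(Z_{p}^{m})=\sum_{l=0}^{m}\ \sum_{(j_{0},j_{1},\ldots,j_{l})\in J_{m}(l)}(-1)^{l+m}\alpha^{j_{0}}(\alpha+1)^{j_{1}}\cdots(\alpha+l)^{j_{l}}\,(R_{p,p}A_{p,p})^{l},$$ where $J_{m}(l)$ is the set of integer tuples $$J_{m}(l)=\{(j_{0},j_{1},\ldots,j_{l})\ :\ j_{0}+\cdots+j_{l}=m;\ j_{i}\ge 1\text{ for } i=0,\ldots,l-1;\ j_{l}\ge 0\}.$$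
   Context: A real matrix $A=\{a_{i,j}\}_{1\le i,j\le n}$ is a nonsingular $M$-matrix if $a_{i,j}\le 0$ for all $i\ne j$, $A$ is nonsingular, and all entries of $A^{-1}$ are nonnegative. $|M|$ denotes the determinant of a matrix $M$. Let $a_i=a_{i,i}=A_{i,i}$ be the diagonal entries of $A$ (they are positive), let $D_A=\mathrm{diag}(a_1,\ldots,a_n)$, and write $A=D_A-B$, so $B$ has nonnegative entries and zero diagonal. Set $\overline A=D_A^{-1}A=I-\overline B$ with $\overline B=D_A^{-1}B$. For $\alpha>0$ the $\alpha$-permanent of an $n\times n$ matrix $M$ is $|M|_\alpha=\sum_{\pi}\alpha^{c(\pi)}M_{1,\pi(1)}M_{2,\pi(2)}\cdots M_{n,\pi(n)}$, where the sum is over all permutations $\pi$ of $\{1,\ldots,n\}$ and $c(\pi)$ is the number of cycles of $\pi$. $\mathbb{N}=\{0,1,2,\ldots\}$. For ${\bf k}=(k_1,\ldots,k_n)\in\mathbb{N}^n$ put $|{\bf k}|=\sum_l k_l$, and for $1\le m\le|{\bf k}|$ let $i_m=j$ where $j$ is determined by $\sum_{l=1}^{j-1}k_l<m\le\sum_{l=1}^{j}k_l$. For an $n\times n$ matrix $C=\{c_{i,j}\}$, $C({\bf k})$ is the $|{\bf k}|\times|{\bf k}|$ matrix with $(p,q)$ entry $c_{i_p,i_q}$; by convention $|C({\bf 0})|_\alpha=1$. $Z=Z_{\alpha,\overline B}$ is an $\mathbb{N}^n$-valued random variable with distribution $P(Z=(k_1,\ldots,k_n))=|\overline A|^{\alpha}\,\dfrac{|\overline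 B({\bf k})|_\alpha}{\prod_{i=1}^n k_i!}$ (these probabilities sum to 1). *)

(* Defs.v *)
From HB Require Import structures.
From mathcomp Require Import all_boot all_order all_algebra all_fingroup.
From mathcomp Require Import all_classical all_reals all_analysis.

Set Implicit Arguments.
Unset Strict Implicit.
Unset Printing Implicit Defensive.

Import Order.TTheory GRing.Theory Num.Theory.

Local Open Scope ring_scope.

Definition nonsingular_M_matrix (R : realType) (n : nat) (A : 'M[R]_n) : Prop :=
  [/\ forall i j : 'I_n, i != j -> A i j <= 0,
      A \in unitmx
    & forall i j : 'I_n, 0 <= invmx A i j].

Definition diag_part (R : realType) (n : nat) (A : 'M[R]_n) : 'M[R]_n :=
  diag_mx (\row_(i < n) A i i).

Definition Abar (R : realType) (n : nat) (A : 'M[R]_n) : 'M[R]_n :=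
  invmx (diag_part A) *m A.

Definition Bbar (R : realType) (n : nat) (A : 'M[R]_n) : 'M[R]_n :=
  invmx (diag_part A) *m (diag_part A - A).

(* [porbits s] is the set of cycles of [s], fixed points included. *)
Definition alpha_permanent (R : realType) (alpha : R) (n : nat) (M : 'M[R]_n) : R :=
  \sum_(s : 'S_n) alpha ^+ #|porbits s| * \prod_(i < n) M i (s i).

(* C(k): row i and column i of C are repeated k_i times. [tagnat.sig1 q] is
   the 0-based form of i_(q+1), see [sig1_partial_sums]. *)
Definition repeat_mx (R : realType) (n : nat) (C : 'M[R]_n) (k : n.-tuple nat) :
    'M[R]_(\sum_(l < n) tnth k l)%N :=
  \matrix_(p, q) C (tagnat.sig1 p) (tagnat.sig1 q).

Lemma sig1_partial_sums (n : nat) (k : n.-tuple nat)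
    (q : 'I_(\sum_(l < n) tnth k l)%N) (j : 'I_n) :
  (tagnat.sig1 q == j) =
  (\sum_(l < n | (l < j)%N) tnth k l <= q < \sum_(l < n | (l <= j)%N) tnth k l)%N.
Proof.
have sumS (i : 'I_n) : (\sum_(l < n | (l <= i)%N) tnth k l =
    \sum_(l < n | (l < i)%N) tnth k l + tnth k i)%N.
  rewrite (bigD1 i) //= addnC; congr addn; apply: eq_bigl => l.
  by rewrite andbC -ltn_neqAle.
have le_sum (P Q : pred 'I_n) : (forall l, P l -> Q l) ->
    (\sum_(l < n | P l) tnth k l <= \sum_(l < n | Q l) tnth k l)%N.
  move=> PQ; rewrite big_mkcond [leqRHS]big_mkcond leq_sum // => l _.
  by case: ifP => // /PQ ->.
have qE : (\sum_(l < n | (l < tagnat.sig1 q)%N) tnth k l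
               + tagnat.sig2 q = q)%N.
  by have := tagnat.rankEsum (tagnat.sig q); rewrite tagnat.sigK.
have q_lt : (q < \sum_(l < n | (l <= tagnat.sig1 q)%N) tnth k l)%N.
  by rewrite sumS -[ltnLHS]qE ltn_add2l.
have q_ge : (\sum_(l < n | (l < tagnat.sig1 q)%N) tnth k l <= q)%N.
  by rewrite -[leqRHS]qE leq_addr.
apply/eqP/idP => [<-|/andP[lo hi]]; first by rewrite q_ge.
case: (ltngtP (tagnat.sig1 q) j) => [ltj|ltj|/val_inj //].
- suff: (q < q)%N by rewrite ltnn.
  apply: leq_trans q_lt (leq_trans (le_sum _ _ _) lo) => l lel.
  exact: leq_ltn_trans lel ltj.
- suff: (q < q)%N by rewrite ltnn.
  apply: leq_trans hi (leq_trans (le_sum _ _ _) q_ge) => l lel.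
  exact: leq_ltn_trans lel ltj.
Qed.

Definition Z_pmf (R : realType) (alpha : R) (n : nat) (A : 'M[R]_n)
    (k : n.-tuple nat) : R :=
  (\det (Abar A)) `^ alpha * alpha_permanent alpha (repeat_mx (Bbar A) k)
  / (\prod_(i < n) (tnth k i)`!)%:R.

(* The entries, being nonnegative with sum m, are at most m: encoding them
   in ['I_m.+1] loses nothing. *)
Definition J (m l : nat) : {set {ffun 'I_l.+1 -> 'I_m.+1}} :=
  [set j : {ffun 'I_l.+1 -> 'I_m.+1} |
    (\sum_(i < l.+1) (j i : nat) == m)%N && [forall i : 'I_l.+1, (i < l)%N ==> (1 <= j i)%N]].

(* Main.v *)
Require Import Defs.
From HB Require Import structures.
From mathcomp Require Import all_boot all_order all_algebra all_fingroup.
From mathcomp Require Import all_classical all_reals all_analysis.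
From mathcomp Require Import ring.

Set Implicit Arguments.
Unset Strict Implicit.
Unset Printing Implicit Defensive.

Import Order.TTheory GRing.Theory Num.Theory.
Import numFieldNormedType.Exports.

Local Open Scope ring_scope.

(** Put [c = R_pp A_pp], which is the diagonal entry at [p] of the inverse of
    [Abar A = 1 - Bbar A], and [f_a = P(Z_p = a)]. The theorem holds because
    the coordinate [Z_p] is negative binomial,
    [(a + 1) f_(a+1) = (1 - 1/c) (alpha + a) f_a] ([coord_prob_rec]), and
    because the negative binomial law has the moments
    [E prod_(i < l) (alpha + i + Z_p) = c^l prod_(i < l) (alpha + i)]
    ([negative_binomial_rising_moment]). Writing the power [z^m] in terms of
    the rising factorials of [alpha + z], the coefficients are up to sign
    complete homogeneous polynomials in [alpha, ..., alpha + l]; multiplied by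
    [prod_(i < l) (alpha + i)], they become the sums over [J m l]
    ([expr_rising_ratio], [J_sumE]).

    The recursion for [f] is obtained from the permutations defining the
    distribution, without generating functions. A configuration is a set of
    points, [k_j] of them of type [j], with a permutation weighted by [alpha]
    per cycle and by the matrix entries along it. Take one more point of type
    [p] and delete it from its cycle. What is left is an open path beginning at
    [p] that has to return to [p]. More generally let [V_i] be the total weight,
    at a fixed value [a] of the coordinate [p], of the configurations with an
    open path from [p] into [i]. Looking at the last step of the path: it comes
    from the added point itself and the path is a new cycle (factor [alpha]);
    or it comes from one of the [a] other points of type [p], and merging that
    point with the added one closes the path without changing the content
    (factor [a]); or it comes from a point of another type [j], and deleting
    that point leaves an open path into [j]. Therefore
    [V_i = (alpha + a) f_a B_pi + sum_(j <> p) V_j B_ji]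
    ([open_weight_rec], [level_open_weight_rec]), while
    [V_p = (a + 1) f_(a+1)] ([open_weight_closed]). This linear system is solved
    with the inverse of [1 - B], whose nonnegativity also shows that the sums
    are finite ([resolvent_limit]), and its entry at [p] is the recursion. *)

(** * Cycles of permutations and expansion of the alpha-permanent *)

(** Cycles are the same on both sides of any map intertwining two
    permutations; it is used for a conjugating permutation and for the
    inclusion [lift 0]. *)
Lemma porbit_equivariant (T U : finType) (h : T -> U) (s : {perm T})
    (t : {perm U}) (x : T) :
  (forall y, t (h y) = h (s y)) -> porbit t (h x) = [set h y | y in porbit s x].
Proof.
move=> sh.
have tX i y : (t ^+ i)%g (h y) = h ((s ^+ i)%g y).
  by elim: i => [|i IH]; rewrite ?expg0 ?perm1 // !expgSr !permM IH sh.
apply/setP => u; apply/porbitP/imsetP => [[i ->]|[y /porbitP[i ->] ->]].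
  by exists ((s ^+ i)%g x); rewrite ?tX ?mem_porbit.
by exists i; rewrite tX.
Qed.

Lemma card_porbits_conj (T : finType) (s t : {perm T}) :
  #|porbits (s ^ t)%g| = #|porbits s|.
Proof.
have h_inj : injective (fun X : {set T} => [set t y | y in X]).
  exact: imset_inj perm_inj.
rewrite -[RHS](card_imset _ h_inj); congr #|pred_of_set _|.
have E x : porbit (s ^ t)%g (t x) = [set t y | y in porbit s x].
  by apply: porbit_equivariant => y; rewrite permJ.
apply/setP => X; apply/imsetP/imsetP => [[y _ ->]|[_ /imsetP[x _ ->] ->]].
  exists (porbit s (t^-1%g y)); first exact: imset_f.
  by rewrite -E permKV.
by exists (t x).
Qed.

Lemma card_porbits_lift0 (N : nat) (t : 'S_N) :
  #|porbits (lift0_perm t)| = #|porbits t|.+1.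
Proof.
have E i : porbit (lift0_perm t) (lift 0 i) = [set lift 0 y | y in porbit t i].
  by apply: porbit_equivariant => y; rewrite lift0_perm_lift.
have h_inj : injective (fun X : {set 'I_N} => [set lift 0 y | y in X]).
  exact/imset_inj/lift_inj.
have E0 : porbit (lift0_perm t) 0 = [set 0].
  apply/setP => y; rewrite inE; apply/porbitP/eqP => [[i ->]|->]; last first.
    by exists 0%N; rewrite expg0 perm1.
  by elim: i => [|i IH]; rewrite ?expg0 ?perm1 // expgSr permM IH lift0_perm0.
rewrite -[#|porbits t|](card_imset _ h_inj).
set S := [set _ | _ in _].
have S0 : [set 0] \notin S.
  apply/imsetP => -[X _ /setP/(_ 0)]; rewrite inE eqxx => /esym/imsetP[y _].
  by move/eqP; rewrite (negbTE (neq_lift _ _)).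
suff -> : porbits (lift0_perm t) = [set 0] |: S by rewrite cardsU1 S0.
apply/setP => X; rewrite in_setU1.
apply/imsetP/orP => [[y _ ->]|[/eqP->|/imsetP[_ /imsetP[x _ ->] ->]]].
- case: (unliftP 0 y) => [i ->|->]; last by left; apply/eqP.
  by right; rewrite E; apply/imset_f/imset_f.
- by exists 0.
- by exists (lift 0 x).
Qed.

(** Multiplying by the transposition either does nothing ([j = 0], where [0]
    stays a cycle of its own) or merges the fixed point [0] into the cycle of
    [j], which gives back the number of cycles of [t]. *)
Lemma card_porbits_tperm_lift0 (N : nat) (j : 'I_N.+1) (t : 'S_N) :
  #|porbits (tperm 0 j * lift0_perm t)%g| = (#|porbits t| + (j == 0%R))%N.
Proof.
have [->|j0] := eqVneq j 0.
  by rewrite tperm1 mul1g card_porbits_lift0 addn1.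
have := porbits_mul_tperm (lift0_perm t) 0 j.
have -> : 0 \notin porbit (lift0_perm t) j.
  apply/porbitP => -[i]; apply/eqP; rewrite eq_sym.
  elim: i => [|i IH]; first by rewrite expg0 perm1.
  by rewrite expgSr permM lift0_perm_eq0.
rewrite card_porbits_lift0 eq_sym j0 /= addn0 addn1 -addn2 => /eqP.
by rewrite eqn_add2r => /eqP.
Qed.

(** A permutation [s] of N+1 points is determined by the preimage [j] of [0]
    and by the permutation of the other points obtained by deleting [0] from
    its cycle; injectivity of the converse map and the count
    (N+1)! = (N+1) N! give the bijection. *)
Lemma sum_perm_tperm_lift0 (V : nmodType) (N : nat) (F : 'S_N.+1 -> V) :
  \sum_s F s = \sum_(j < N.+1) \sum_(t : 'S_N) F (tperm 0 j * lift0_perm t)%g.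
Proof.
rewrite pair_bigA /=.
pose h (x : 'I_N.+1 * 'S_N) := (tperm 0 x.1 * lift0_perm x.2)%g.
have h_inj : injective h.
  move=> [j t] [j' t'] /= /permP E.
  have jj' : j = j'.
    have := E j; rewrite !permM tpermR lift0_perm0 => /esym/eqP.
    rewrite lift0_perm_eq0.
    by rewrite -(inj_eq (@perm_inj _ (tperm 0 j'))) tpermK tpermL => /eqP.
  move: E; rewrite -jj' => E; congr (_, _); apply/permP => i.
  have := E (tperm 0 j (lift 0 i)).
  by rewrite !permM tpermK !lift0_perm_lift => /lift_inj.
rewrite (reindex h) //; apply/onW_bij/inj_card_bij => //.
by rewrite card_prod card_ord !card_Sn factS.
Qed.

(** Unlike the Laplace expansion of a determinant, deleting the row of [j] and
    the column of [0] would lose track of cycles: here the points [0] and [j]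
    are merged into one that keeps the column of [j] and the row of [0]
    (the [tperm] in the row index), so that no cycle is created or destroyed
    unless [j = 0]. *)
Lemma alpha_permanent_expand (R : realType) (alpha : R) (N : nat)
    (M : 'M[R]_N.+1) :
  alpha_permanent alpha M =
  \sum_(j < N.+1) alpha ^+ (j == 0) * M j 0 *
    alpha_permanent alpha
      (\matrix_(i < N, k < N) M (tperm 0 j (lift 0 i)) (lift 0 k)).
Proof.
rewrite /alpha_permanent sum_perm_tperm_lift0; apply: eq_bigr => j _.
rewrite mulr_sumr; apply: eq_bigr => t _.
rewrite card_porbits_tperm_lift0 exprD.
rewrite (reindex_inj (@perm_inj _ (tperm 0 j))) big_ord_recl /=.
rewrite permM tpermK lift0_perm0 tpermL [_ * alpha ^+ _]mulrC mulrACA.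
congr (_ * (_ * _)); apply: eq_bigr => i _.
by rewrite permM tpermK lift0_perm_lift mxE.
Qed.

Lemma alpha_permanent_conj (R : realType) (alpha : R) (N : nat)
    (M : 'M[R]_N) (t : 'S_N) :
  alpha_permanent alpha (\matrix_(i, j) M (t i) (t j)) =
  alpha_permanent alpha M.
Proof.
rewrite /alpha_permanent [RHS](reindex_inj (@conjg_inj _ t)) /=.
apply: eq_bigr => s _; rewrite card_porbits_conj; congr (_ * _).
rewrite [RHS](reindex_inj (@perm_inj _ t)) /=.
by apply: eq_bigr => i _; rewrite mxE permJ.
Qed.

(** * Alpha-permanents of labelled points *)

(** An entry [(r, c)] of [s] is a point whose row is that of [r] and whose
    column is that of [c]. Rows and columns have to be labelled separately
    because the merging in [alpha_permanent_expand] produces points with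
    [r <> c]; in exchange the expansion stays within this class. *)
Definition label_permanent (R : realType) (alpha : R) (I : Type)
    (B : I -> I -> R) (s : seq (I * I)) : R :=
  alpha_permanent alpha (\matrix_(i < size s, j < size s)
    B (tnth (in_tuple s) i).1 (tnth (in_tuple s) j).2).

Lemma label_permanent_tuple (R : realType) (alpha : R) (I : Type)
    (B : I -> I -> R) (N : nat) (t : N.-tuple (I * I)) :
  label_permanent alpha B t =
  alpha_permanent alpha (\matrix_(i, j) B (tnth t i).1 (tnth t j).2).
Proof.
case: t => s sN; have /eqP eN := sN; move: sN; rewrite -{N}eN => sN.
by rewrite /label_permanent; have -> : Tuple sN = in_tuple s by exact: val_inj.
Qed.

(** Simultaneous permutation of rows and columns is a conjugation of the
    summation index, so only the multiset of labels matters. *)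
Lemma perm_label_permanent (R : realType) (alpha : R) (I : eqType)
    (B : I -> I -> R) (s t : seq (I * I)) :
  perm_eq s t -> label_permanent alpha B s = label_permanent alpha B t.
Proof.
move=> st; have /tuple_permP[u sE] : perm_eq s (in_tuple t) by [].
rewrite sE label_permanent_tuple [RHS]/label_permanent -[RHS](alpha_permanent_conj _ _ u).
congr (alpha_permanent _ _); apply/matrixP => i j.
by rewrite !mxE !tnth_mktuple.
Qed.

Lemma perm_set_nth_rem (T : eqType) (x0 z : T) (s : seq T) (i : nat) :
  (i < size s)%N -> perm_eq (set_nth x0 s i z) (z :: rem (nth x0 s i) s).
Proof.
move=> i_lt; rewrite set_nthE i_lt.
have s_split : s = take i s ++ nth x0 s i :: drop i.+1 s.
  by rewrite -drop_nth // cat_take_drop.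
rewrite -cat_rcons -cats1 -catA perm_catCA /= perm_cons.
rewrite -(perm_cons (nth x0 s i)).
rewrite perm_sym -(permPl (perm_to_rem (mem_nth x0 i_lt))).
by rewrite [X in perm_eq X _]s_split -cat1s perm_catCA.
Qed.

(** The expansion along the column of the first point: merging it with the
    point [y] leaves a point with row [i] and column [y.2]. *)
Lemma label_permanent_cons (R : realType) (alpha : R) (I : eqType)
    (B : I -> I -> R) (i c : I) (s : seq (I * I)) :
  label_permanent alpha B ((i, c) :: s) =
  alpha * B i c * label_permanent alpha B s +
  \sum_(y <- s) B y.1 c * label_permanent alpha B ((i, y.2) :: rem y s).
Proof.
have tnth_lift (j : 'I_(size s)) :
    tnth (in_tuple ((i, c) :: s)) (lift ord0 j) = tnth (in_tuple s) j.
  by rewrite !(tnth_nth (i, c)).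
rewrite {1}/label_permanent alpha_permanent_expand big_ord_recl /=.
rewrite expr1 mxE /=; congr (_ * _ + _).
  congr (alpha_permanent _ _); apply/matrixP => j k.
  by rewrite !mxE tperm1 perm1 !tnth_lift.
rewrite [RHS](big_nth (i, c)) big_mkord; apply: eq_bigr => x _.
rewrite mul1r mxE tnth_lift (tnth_nth (i, c)) /=; congr (_ * _).
set y := nth _ _ _.
rewrite -(perm_label_permanent _ _ (perm_set_nth_rem _ _ (ltn_ord x))).
have usz : size (set_nth (i, c) s x (i, y.2)) == size s.
  by rewrite size_set_nth; apply/eqP/maxn_idPr.
rewrite -[set_nth _ _ _ _]/(tval (Tuple usz)) label_permanent_tuple.
congr (alpha_permanent _ _); apply/matrixP => j k; rewrite !mxE tnth_lift.
rewrite !(tnth_nth (i, c)) /= !nth_set_nth /=.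
have -> : (if (k : nat) == x then (i, y.2) else nth (i, c) s k).2 =
    (nth (i, c) s k).2.
  by case: eqP => [kx|//]; rewrite /y -kx.
congr (B _ _).
case: (eqVneq j x) => [->|jx]; first by rewrite eqxx tpermR.
rewrite (inj_eq val_inj) (negbTE jx) tpermD ?neq_lift //.
by rewrite (inj_eq lift_inj) eq_sym.
Qed.

(** * Weights of closed and open configurations *)

Definition incr_tuple (n : nat) (k : n.-tuple nat) (j : 'I_n) : n.-tuple nat :=
  [tuple (tnth k l + (l == j))%N | l < n].

Definition decr_tuple (n : nat) (k : n.-tuple nat) (j : 'I_n) : n.-tuple nat :=
  [tuple (tnth k l - (l == j))%N | l < n].

Lemma decr_tupleK (n : nat) (k : n.-tuple nat) (j : 'I_n) :
  (0 < tnth k j)%N -> incr_tuple (decr_tuple k j) j = k.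
Proof.
move=> kj; apply: eq_from_tnth => l; rewrite !tnth_mktuple.
by case: eqVneq => [->|_]; rewrite ?subnK // subn0 addn0.
Qed.

Lemma incr_tupleK (n : nat) (k : n.-tuple nat) (j : 'I_n) :
  decr_tuple (incr_tuple k j) j = k.
Proof. by apply: eq_from_tnth => l; rewrite !tnth_mktuple addnK. Qed.

Lemma prod_fact_incr (n : nat) (k : n.-tuple nat) (j : 'I_n) :
  (\prod_(i < n) (tnth (incr_tuple k j) i)`! =
   (tnth k j).+1 * \prod_(i < n) (tnth k i)`!)%N.
Proof.
rewrite (bigD1 j) //= [in RHS](bigD1 j) //= tnth_mktuple eqxx addn1 factS mulnA.
congr (_ * _)%N; apply: eq_bigr => i /negbTE ij.
by rewrite tnth_mktuple ij addn0.
Qed.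

Lemma sum_incr_tuple (n : nat) (k : n.-tuple nat) (j : 'I_n) :
  (\sum_(i < n) tnth (incr_tuple k j) i = (\sum_(i < n) tnth k i).+1)%N.
Proof.
under eq_bigr => i _ do rewrite tnth_mktuple.
rewrite big_split /= -addn1; congr (_ + _)%N.
by rewrite -big_mkcond /= big_pred1_eq.
Qed.

Definition content_word (n : nat) (k : n.-tuple nat) : seq 'I_n :=
  [seq tagnat.sig1 q | q : 'I_(\sum_(l < n) tnth k l)%N].

Lemma count_content_word (n : nat) (k : n.-tuple nat) (j : 'I_n) :
  count_mem j (content_word k) = tnth k j.
Proof.
rewrite /content_word count_map -sum1_count big_enum_cond /=.
rewrite big_mkcond /= (reindex (@tagnat.rank n (tnth k))) /=; last first.
  exact: tagnat.rank_bij_on.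
under eq_bigr => x _ do rewrite /tagnat.sig1 tagnat.rankK.
rewrite -(@sig_big_dep _ _ _ _ _ xpredT (fun _ _ => true)
  (fun l _ => if l == j then 1 else 0)%N) /=.
rewrite (bigD1 j) //= eqxx sum_nat_const card_ord muln1.
rewrite big1 ?addn0 // => i /negbTE ->.
by rewrite big1.
Qed.

Lemma perm_content_word_incr (n : nat) (k : n.-tuple nat) (j : 'I_n) :
  perm_eq (content_word (incr_tuple k j)) (j :: content_word k).
Proof.
apply/allP => x _ /=; rewrite !count_content_word tnth_mktuple addnC.
by rewrite (eq_sym x).
Qed.

Lemma sum_seq_count (R : pzSemiRingType) (I : finType) (g : I -> R) (s : seq I) :
  \sum_(y <- s) g y = \sum_j (count_mem j s)%:R * g j.
Proof.
elim: s => [|y s IH]; first by rewrite big_nil big1 // => j _; rewrite mul0r.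
rewrite big_cons IH.
under [RHS]eq_bigr => j _ do rewrite /= natrD mulrDl.
rewrite big_split /=; congr (_ + _).
rewrite (bigD1 y) //= eqxx mul1r big1 ?addr0 // => j /negbTE.
by rewrite eq_sym => ->; rewrite mul0r.
Qed.

Definition diag_labels (I : Type) (s : seq I) : seq (I * I) :=
  [seq (i, i) | i <- s].

Definition weight (R : realType) (alpha : R) (n : nat) (B : 'M[R]_n)
    (k : n.-tuple nat) : R :=
  label_permanent alpha B (diag_labels (content_word k))
  / (\prod_(i < n) (tnth k i)`!)%:R.

(** Normalized sums over configurations with content [k] and one extra point
    having row [p] and column [i]: cutting a cycle at such a point leaves a
    path that starts at [p] and ends by entering [i]. *)
Definition open_weight (R : realType) (alpha : R) (n : nat) (B : 'M[R]_n)
    (p i : 'I_n) (k : n.-tuple nat) : R :=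
  label_permanent alpha B ((p, i) :: diag_labels (content_word k))
  / (\prod_(i < n) (tnth k i)`!)%:R.

Lemma alpha_permanent_repeat_mx (R : realType) (alpha : R) (n : nat)
    (C : 'M[R]_n) (k : n.-tuple nat) :
  alpha_permanent alpha (repeat_mx C k) =
  label_permanent alpha C (diag_labels (content_word k)).
Proof.
pose t := [tuple (@tagnat.sig1 n (tnth k) q, @tagnat.sig1 n (tnth k) q)
  | q < (\sum_(l < n) tnth k l)%N].
have -> : diag_labels (content_word k) = t.
  by rewrite /diag_labels /content_word -map_comp.
rewrite label_permanent_tuple; congr (alpha_permanent _ _).
by apply/matrixP => i j; rewrite !mxE !tnth_mktuple.
Qed.

(** For [i = p] the extra point is an ordinary one of type [p]; the factor is
    what the product of factorials gains. *)
Lemma open_weight_closed (R : realType) (alpha : R) (n : nat) (B : 'M[R]_n)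
    (p : 'I_n) (k : n.-tuple nat) :
  open_weight alpha B p p k =
  (tnth k p).+1%:R * weight alpha B (incr_tuple k p).
Proof.
rewrite /weight /open_weight prod_fact_incr natrM invfM mulrCA mulVKf ?pnatr_eq0 //.
congr (_ / _); apply: perm_label_permanent.
by rewrite perm_sym; apply: (perm_map (fun i => (i, i))) (perm_content_word_incr k p).
Qed.

(** The last step of the open path enters [i] either from [p] directly,
    closing a cycle (hence the factor [alpha]), or from one of the [k_j]
    points of type [j]. These [k_j] equal terms turn [1 / k_j!] into
    [1 / (k_j - 1)!], so that the normalized weights satisfy a recursion
    without multiplicities. *)
Lemma open_weight_rec (R : realType) (alpha : R) (n : nat) (B : 'M[R]_n)
    (p i : 'I_n) (k : n.-tuple nat) :
  open_weight alpha B p i k =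
  alpha * B p i * weight alpha B k +
  \sum_j B j i * (if (0 < tnth k j)%N
                  then open_weight alpha B p j (decr_tuple k j) else 0).
Proof.
rewrite {1}/open_weight label_permanent_cons mulrDl -mulrA; congr (_ + _).
rewrite big_map /= sum_seq_count mulr_suml; apply: eq_bigr => j _.
rewrite count_content_word; case: ifP => [kj|]; last first.
  by move/negbT; rewrite -eqn0Ngt => /eqP ->; rewrite !(mul0r, mulr0).
set k' := decr_tuple k j; have kE : k = incr_tuple k' j by rewrite decr_tupleK.
have -> : tnth k j = (tnth k' j).+1 by rewrite kE tnth_mktuple eqxx addn1.
have -> : (\prod_(l < n) (tnth k l)`! =
    (tnth k' j).+1 * \prod_(l < n) (tnth k' l)`!)%N.
  by rewrite kE prod_fact_incr.
rewrite natrM invfM mulrACA divff ?pnatr_eq0 // mul1r -mulrA; congr (_ * _).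
rewrite /open_weight; congr (_ / _); apply: perm_label_permanent.
rewrite perm_cons -(perm_cons (j, j)).
rewrite -(permPl (perm_to_rem _)) /=; last first.
  by apply: map_f; rewrite -has_pred1 has_count count_content_word.
rewrite {1}kE.
exact: (perm_map (fun i => (i, i))) (perm_content_word_incr k' j).
Qed.

Lemma alpha_permanent_ge0 (R : realType) (alpha : R) (N : nat) (M : 'M[R]_N) :
  0 <= alpha -> (forall i j, 0 <= M i j) -> 0 <= alpha_permanent alpha M.
Proof.
move=> a0 M0; apply: sumr_ge0 => s _; apply: mulr_ge0; first exact: exprn_ge0.
exact: prodr_ge0.
Qed.

Lemma open_weight_ge0 (R : realType) (alpha : R) (n : nat) (B : 'M[R]_n)
    (p i : 'I_n) (k : n.-tuple nat) :
  0 <= alpha -> (forall i j, 0 <= B i j) -> 0 <= open_weight alpha B p i k.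
Proof.
move=> a0 B0; rewrite divr_ge0 //.
by apply: alpha_permanent_ge0 => // j l; rewrite mxE.
Qed.

(** * Summation at a fixed value of one coordinate *)

Local Open Scope classical_set_scope.

(** Finite truncations of the event where the coordinate [p] is [a], by total
    size; adding one unit maps one truncation into the next, so the recursion
    for weights sums up exactly. *)
Definition level (n : nat) (p : 'I_n) (N a : nat) : set (n.-tuple nat) :=
  [set k | (\sum_(i < n) tnth k i < N)%N /\ tnth k p = a].

Lemma finite_level (n : nat) (p : 'I_n) (N a : nat) :
  finite_set (level p N a).
Proof.
case: N => [|N]; first by apply: (sub_finite_set _ (finite_set0 _)) => k [].
apply: (@sub_finite_set _ _
  [set [tuple (f i : nat) | i < n] | f in [set: {ffun 'I_n -> 'I_N.+1}]]).
  move=> k [k_lt _]; exists [ffun i => inord (tnth k i)] => //.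
  apply: eq_from_tnth => i; rewrite tnth_mktuple ffunE inordK //.
  by apply: leq_ltn_trans k_lt; rewrite (bigD1 i) //= leq_addr.
exact/finite_image/finite_finset.
Qed.

Lemma level_bij_incr (n : nat) (p j : 'I_n) (N a : nat) :
  set_bij (level p N a)
    (level p N.+1 (a + (p == j))%N `&` [set k | (0 < tnth k j)%N])
    (fun k => incr_tuple k j).
Proof.
split.
- move=> k [k_lt kp] /=; split; last by rewrite tnth_mktuple eqxx addn1.
  by split; rewrite ?sum_incr_tuple // tnth_mktuple kp.
- by move=> k k' _ _ /(congr1 (fun k => decr_tuple k j)); rewrite !incr_tupleK.
- move=> k [[k_lt kp] kj]; exists (decr_tuple k j); last exact: decr_tupleK.
  rewrite -(decr_tupleK kj) sum_incr_tuple tnth_mktuple in k_lt kp.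
  by split=> //; move/addIn: kp.
Qed.

Section LevelSums.
Context (R : realType) (alpha : R) (n : nat) (B : 'M[R]_n) (p : 'I_n).

Definition level_weight (N a : nat) : R :=
  \sum_(k \in level p N a) weight alpha B k.

Definition level_open_weight (N a : nat) (i : 'I_n) : R :=
  \sum_(k \in level p N a) open_weight alpha B p i k.

Lemma level_open_weight_closed (N a : nat) :
  level_open_weight N a p = a.+1%:R * level_weight N.+1 a.+1.
Proof.
rewrite /level_open_weight /level_weight.
have -> : level p N.+1 a.+1 =
    level p N.+1 (a + (p == p))%N `&` [set k | (0 < tnth k p)%N].
  rewrite eqxx addn1; apply/seteqP; split => [k [k_lt kp]|k []//].
  by split=> //=; rewrite kp.
rewrite (reindex_fsbig _ _ _ _ (level_bij_incr p p N a)).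
rewrite !fsbig_finite; try exact: finite_level.
rewrite mulr_sumr; apply: eq_big_seq => k.
rewrite in_fset_set; last exact: finite_level.
by rewrite inE => -[_ kp]; rewrite open_weight_closed kp.
Qed.

(** In [open_weight_rec] the term [j = p] lowers the coordinate [p] and is
    therefore no open weight at the same [a]; by [open_weight_closed] it is
    [a] times the closed weight, which turns [alpha] into [alpha + a]. *)
Lemma level_open_weight_rec (N a : nat) (i : 'I_n) :
  level_open_weight N.+1 a i =
  (alpha + a%:R) * B p i * level_weight N.+1 a +
  \sum_(j | j != p) B j i * level_open_weight N a j.
Proof.
rewrite /level_open_weight /level_weight.
have fin M b : finite_set (level p M b) by exact: finite_level.
pose G k j := if (0 < tnth k j)%N
  then open_weight alpha B p j (decr_tuple k j) else 0.
have GpE k : G k p = (tnth k p)%:R * weight alpha B k.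
  rewrite /G; case: ifP => [kp|/negbT]; last first.
    by rewrite -eqn0Ngt => /eqP ->; rewrite mul0r.
  rewrite open_weight_closed decr_tupleK // tnth_mktuple eqxx subn1.
  by rewrite prednK.
have GE j : j != p -> \sum_(k \in level p N.+1 a) G k j =
    \sum_(k \in level p N a) open_weight alpha B p j k.
  move=> /negbTE jp; transitivity (\sum_(k \in level p N.+1 a `&`
      [set k | (0 < tnth k j)%N]) open_weight alpha B p j (decr_tuple k j)).
    rewrite [RHS]fsbig_mkcondr !(fsbig_finite _ _ (fin _ _)); apply: eq_bigr => k _.
    by rewrite /G; congr (if _ then _ else _); rewrite mem_setE.
  have -> : level p N.+1 a = level p N.+1 (a + (p == j))%N.
    by rewrite eq_sym jp addn0.
  rewrite (reindex_fsbig _ _ _ _ (level_bij_incr p j N a)).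
  rewrite !(fsbig_finite _ _ (fin _ _)); apply: eq_bigr => k _.
  by rewrite incr_tupleK.
have EV k : level p N.+1 a k -> open_weight alpha B p i k =
    (alpha + a%:R) * B p i * weight alpha B k +
    \sum_(j | j != p) B j i * G k j.
  move=> [_ kp]; rewrite open_weight_rec (bigD1 p) //= -/(G k p) GpE kp addrA; congr (_ + _).
  ring.
rewrite !(fsbig_finite _ _ (fin N.+1 _)).
under eq_big_seq => k do [rewrite in_fset_set // inE => /EV ->].
rewrite big_split /= -mulr_sumr.
congr (_ + _); rewrite exchange_big /=; apply: eq_bigr => j jp.
by rewrite -mulr_sumr -GE // (fsbig_finite _ _ (fin _ _)).
Qed.

Lemma level_open_weight_ge0 (N a : nat) (i : 'I_n) :
  0 <= alpha -> (forall i j, 0 <= B i j) -> 0 <= level_open_weight N a i.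
Proof.
move=> alpha_ge0 B_ge0.
rewrite /level_open_weight fsbig_finite; last exact: finite_level.
by apply: sumr_ge0 => k _; exact: open_weight_ge0.
Qed.

Lemma level_open_weight_nondecreasing (a : nat) (i : 'I_n) :
  0 <= alpha -> (forall i j, 0 <= B i j) ->
  nondecreasing_seq (fun N => level_open_weight N a i).
Proof.
move=> alpha_ge0 B_ge0.
apply/nondecreasing_seqP => N; rewrite /level_open_weight.
have sub : level p N a `<=` level p N.+1 a.
  by move=> k [/ltnW k_lt kp]; split.
rewrite [leRHS](fsbigID (level p N a)); last exact: finite_level.
rewrite setIidr //= lerDl fsbig_finite; last exact/finite_setD/finite_level.
by apply: sumr_ge0 => k _; exact: open_weight_ge0.
Qed.

End LevelSums.

(** * M-matrices and the resolvent *)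

(** In the diagonal entry of [A *m invmx A = 1] all off-diagonal contributions
    are nonpositive, so the product of the two diagonal entries is at least
    1. *)
Lemma M_matrix_diag_gt0 (R : realType) (n : nat) (A : 'M[R]_n) (p : 'I_n) :
  nonsingular_M_matrix A -> 0 < A p p /\ 1 <= invmx A p p * A p p.
Proof.
move=> [A_le0 A_unit R_ge0].
have c1 : 1 <= invmx A p p * A p p.
  have : (A *m invmx A) p p = 1 by rewrite mulmxV // mxE eqxx.
  rewrite mxE (bigD1 p) //= mulrC => E; rewrite -[leLHS]E gerDl.
  apply: sumr_le0 => j jp; apply: mulr_le0_ge0 => //.
  by apply: A_le0; rewrite eq_sym.
split=> //; rewrite ltNge; apply: contraTN c1 => App_le0.
by rewrite -ltNge (le_lt_trans _ ltr01) // mulr_ge0_le0.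
Qed.

Lemma diag_part_unit (R : realType) (n : nat) (A : 'M[R]_n) :
  nonsingular_M_matrix A -> diag_part A \in unitmx /\
  invmx (diag_part A) = diag_mx (\row_i (A i i)^-1).
Proof.
move=> MA; set D' := diag_mx _.
have DD' : diag_part A *m D' = 1%:M.
  apply/matrixP => i j; rewrite mul_diag_mx !mxE.
  have [Aii _] := M_matrix_diag_gt0 i MA.
  by case: eqVneq => _; rewrite ?mulr0n ?mulr0 // !mulr1n divff ?gt_eqF.
have [D_unit _] := mulmx1_unit DD'.
by split=> //; rewrite -[RHS](mulKmx D_unit) DD' mulmx1.
Qed.

Lemma Abar_unit (R : realType) (n : nat) (A : 'M[R]_n) :
  nonsingular_M_matrix A -> Abar A \in unitmx.
Proof.
move=> MA; have [D_unit _] := diag_part_unit MA.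
by case: MA => _ A_unit _; rewrite unitmx_mul unitmx_inv D_unit.
Qed.

Lemma invmx_AbarE (R : realType) (n : nat) (A : 'M[R]_n) (i j : 'I_n) :
  nonsingular_M_matrix A -> invmx (Abar A) i j = invmx A i j * A j j.
Proof.
move=> MA; have [D_unit _] := diag_part_unit MA.
have E : invmx A *m diag_part A = invmx (Abar A).
  rewrite -[LHS](mulmxK (Abar_unit MA)) [X in X *m _]mulmxA mulmxK //.
  by case: MA => _ A_unit _; rewrite mulVmx // mul1mx.
by rewrite -E mul_mx_diag !mxE.
Qed.

Lemma BbarE (R : realType) (n : nat) (A : 'M[R]_n) :
  nonsingular_M_matrix A -> Bbar A = 1%:M - Abar A.
Proof.
by move=> /diag_part_unit[D_unit _]; rewrite /Bbar mulmxBr mulVmx.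
Qed.

Lemma Bbar_ge0 (R : realType) (n : nat) (A : 'M[R]_n) (i j : 'I_n) :
  nonsingular_M_matrix A -> 0 <= Bbar A i j.
Proof.
move=> MA; have [_ DE] := diag_part_unit MA.
rewrite /Bbar DE mul_diag_mx !mxE mulr_ge0 //.
  by rewrite invr_ge0 ltW //; case: (M_matrix_diag_gt0 i MA).
case: eqVneq => [->|ij]; first by rewrite mulr1n subrr.
by rewrite mulr0n sub0r oppr_ge0; case: MA => + _ _; apply.
Qed.

(** With [B = 1 - C] and [x] the limit of [y F - v_p], the limit [w] of the row
    vectors [v] solves [w = x B_p + w B], so [w = x B_p C^-1], whose entry at
    [p] is [x (C^-1 p p - 1)]. The sequence converges because it increases and,
    [C^-1] being nonnegative, [v (1 - B) <= y f B_p] implies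
    [v <= y f B_p C^-1]. *)
Lemma resolvent_limit (R : realType) (n : nat) (C : 'M[R]_n) (p : 'I_n)
    (v : nat -> 'I_n -> R) (F G : nat -> R) (f g y z : R) :
  C \in unitmx ->
  (forall i j, 0 <= invmx C i j) -> (forall i j, 0 <= (1%:M - C) i j) ->
  0 <= y -> (forall N, F N <= f) -> F @ \oo --> f -> G @ \oo --> g ->
  (forall N i, 0 <= v N i) ->
  (forall i, nondecreasing_seq (fun N => v N i)) ->
  (forall N i, v N.+1 i = y * (1%:M - C) p i * F N.+1 +
    \sum_(j | j != p) (1%:M - C) j i * v N j) ->
  (forall N, v N p = z * G N.+1) ->
  z * g * invmx C p p = (invmx C p p - 1) * (y * f).
Proof.
move=> C_unit Cinv_ge0; set B := 1%:M - C => B_ge0 y0 F_le Ff Gg v0 v_nd v_rec v_p.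
pose h := row p B *m invmx C.
have hE i : h 0 i = invmx C p i - (p == i)%:R.
  by rewrite /h /B -row_mul mulmxBl mul1mx mulmxV // !mxE.
have h_ge0 i : 0 <= h 0 i.
  by rewrite mxE sumr_ge0 // => j _; rewrite mxE mulr_ge0.
pose V N := \row_i v N i.
have V_rec N : V N.+1 = (y * F N.+1 - v N p) *: row p B + V N *m B.
  apply/rowP => i; rewrite !mxE v_rec [X in _ = _ + X](bigD1 p) //= !mxE.
  rewrite addrA; congr (_ + _); last by apply: eq_bigr => j _; rewrite [V N 0 j]mxE mulrC.
  ring.
have VE N : V N = (y * F N.+1 - v N p) *: h - (V N.+1 - V N) *m invmx C.
  rewrite /h scalemxAl -mulmxBl -[LHS](mulmxK C_unit); congr (_ *m _).
  have -> : C = 1%:M - B by rewrite /B subKr.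
  by rewrite mulmxBr mulmx1 V_rec opprB addrCA opprD [X in _ = _ + X]addrA subrr add0r.
have vE N i : v N i = (y * F N.+1 - v N p) * h 0 i -
    \sum_j (v N.+1 j - v N j) * invmx C j i.
  have /rowP/(_ i) := VE N; rewrite !mxE => ->; congr (_ - _).
  by apply: eq_bigr => j _; rewrite !mxE.
(* In vE the increments are nonnegative and are subtracted, and
   y F - v_p <= y f. *)
have v_le N i : v N i <= y * f * h 0 i.
  rewrite vE lerBlDr; apply: (@le_trans _ _ (y * f * h 0 i)).
    rewrite ler_wpM2r // lerBlDr (le_trans (ler_wpM2l y0 (F_le _))) //.
    by rewrite lerDl.
  rewrite lerDl sumr_ge0 // => j _; rewrite mulr_ge0 // subr_ge0.
  exact/v_nd/leqnSn.
have v_cvg i : cvgn (fun N => v N i).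
  apply: nondecreasing_is_cvgn => //; exists (y * f * h 0 i).
  by move=> _ [N _ <-].
pose w i := limn (fun N => v N i).
have vS i : v N.+1 i @[N --> \oo] --> w i.
  by rewrite (cvg_shiftS (fun N => v N i)); exact: v_cvg.
have wpE : w p = z * g.
  apply/cvg_lim => //; under eq_fun => N do rewrite v_p.
  by apply: cvgMl_tmp; rewrite (cvg_shiftS G).
have RHS_cvg : v N p @[N --> \oo] --> (y * f - w p) * h 0 p -
    \sum_j (w j - w j) * invmx C j p.
  under eq_fun => N do rewrite vE.
  apply: cvgB.
    apply: cvgMr_tmp; apply: cvgB; last exact: v_cvg.
    by apply: cvgMl_tmp; rewrite (cvg_shiftS F).
  apply: cvg_big => [|j _]; first exact: add_continuous.
  apply: cvgMr_tmp; apply: cvgB; first exact: vS.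
  exact: v_cvg.
have := cvg_unique (@Rhausdorff R) RHS_cvg (v_cvg p).
rewrite -/(w p) wpE hE eqxx mulr1n big1 => [|j _]; last by rewrite subrr mul0r.
rewrite subr0; set c := invmx C p p => E.
have -> : (c - 1) * (y * f) = (y * f - z * g) * (c - 1) + z * g * (c - 1) by ring.
by rewrite E; ring.
Qed.

(** * Rising factorial moments and the index sets J *)

Definition J_sum (R : realType) (alpha : R) (m l : nat) : R :=
  \sum_(j in J m l) \prod_(i < l.+1) (alpha + i%:R) ^+ (j i).

(** The truncated geometric series of [x 'X]; the truncation at degree [M] does
    not affect coefficients of degree at most [M]. *)
Definition geom_poly (R : realType) (M : nat) (x : R) : {poly R} :=
  \poly_(t < M.+1) x ^+ t.

(** Its coefficient of degree [M] is the sum over [J M l]: removing the constant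
    term 1 of a factor imposes a positive exponent. Keeping the truncation [M]
    separate from the degree that is read off makes an induction on the
    degree possible. *)
Definition J_poly (R : realType) (alpha : R) (M l : nat) : {poly R} :=
  (\prod_(i < l) (geom_poly M (alpha + i%:R) - 1)) * geom_poly M (alpha + l%:R).

Lemma J_sumE (R : realType) (alpha : R) (m l : nat) :
  J_sum alpha m l = (J_poly alpha m l)`_m.
Proof.
have geomE (b : bool) (x : R) : geom_poly m x - b%:R =
    \sum_(t < m.+1) ((b ==> (1 <= t)%N)%:R * x ^+ t) *: 'X^t.
  rewrite /geom_poly poly_def !big_ord_recl /= expr0 scale1r.
  case: b; rewrite /= !(mul0r, mul1r, scale0r, scale1r, add0r, subr0).
    by rewrite addrAC subrr add0r; apply: eq_bigr => t _; rewrite mul1r.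
  by congr (_ + _); apply: eq_bigr => t _; rewrite mul1r.
have -> : J_poly alpha m l = \prod_(i < l.+1)
    \sum_(t < m.+1) (((i < l)%N ==> (1 <= t)%N)%:R * (alpha + i%:R) ^+ t) *: 'X^t.
  rewrite big_ord_recr; congr (_ * _).
    by apply: eq_bigr => i _; rewrite (geomE true) /= ltn_ord.
  by rewrite -[LHS]subr0 (geomE false) /= ltnn.
rewrite bigA_distr_bigA coef_sum /J_sum big_mkcond; apply: eq_bigr => j _.
rewrite scaler_prod coefZ prodrXr coefXn big_split /= inE eq_sym.
have -> : \prod_(i < l.+1) ((i < l)%N ==> (1 <= j i)%N)%:R =
    ([forall i : 'I_l.+1, (i < l)%N ==> (1 <= j i)%N])%:R :> R.
  case: forallP => [H|/forallP]; first by rewrite big1 // => i _; rewrite H.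
  rewrite negb_forall => /existsP[i Hi].
  by rewrite (bigD1 i) //= (negbTE Hi) mul0r.
by case: eqP => _; case: forallP => _; rewrite !(mulr1, mul1r, mulr0, mul0r).
Qed.

Section JRecursion.
Context (R : realType) (alpha : R) (M : nat).

(** Up to the truncation degree, [geom x - 1] is [x 'X geom x]. *)
Lemma coef_geom_sub1 (U : {poly R}) (x : R) (m : nat) : (m < M)%N ->
  (U * (geom_poly M x - 1))`_m.+1 = x * (U * geom_poly M x)`_m.
Proof.
move=> mM; rewrite !coefM big_ord_recr /= subnn coefB coef_poly coefC /=.
rewrite subrr mulr0 addr0 mulr_sumr; apply: eq_bigr => j _.
have jm : (j <= m)%N by rewrite -ltnS.
have mjM : (m - j < M)%N by rewrite (leq_ltn_trans (leq_subr _ _)).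
rewrite (subSn jm) coefB !coef_poly coefC /= subr0 ltnS mjM ltnS ltnW //.
by rewrite exprS mulrCA.
Qed.

Lemma coef_mul_geom (U : {poly R}) (x : R) (m : nat) : (m < M)%N ->
  (U * geom_poly M x)`_m.+1 = U`_m.+1 + x * (U * geom_poly M x)`_m.
Proof.
move=> mM; rewrite -coef_geom_sub1 // -coefD.
by rewrite mulrBr mulr1 addrCA subrr addr0.
Qed.

Lemma coef_J_poly_recl (m : nat) : (m < M)%N ->
  (J_poly alpha M 0)`_m.+1 = alpha * (J_poly alpha M 0)`_m.
Proof.
by move=> mM; rewrite /J_poly big_ord0 coef_mul_geom // coefC /= add0r addr0.
Qed.

Lemma coef_J_poly_rec (m l : nat) : (m < M)%N ->
  (J_poly alpha M l.+1)`_m.+1 =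
  (alpha + l%:R) * (J_poly alpha M l)`_m +
  (alpha + l.+1%:R) * (J_poly alpha M l.+1)`_m.
Proof.
move=> mM; rewrite {1}/J_poly coef_mul_geom // big_ord_recr /=.
by rewrite coef_geom_sub1 // /J_poly big_ord_recr.
Qed.

Lemma coef_J_poly_eq0 (m l : nat) : (m <= M)%N -> (m < l)%N ->
  (J_poly alpha M l)`_m = 0.
Proof.
elim: m l => [|m IH] [|l] // mM ml.
  rewrite /J_poly big_ord_recr /= !coef0M coefB coef_poly coefC /=.
  by rewrite expr0 subrr mulr0 mul0r.
by rewrite coef_J_poly_rec // !IH ?mulr0 ?addr0 // ?(ltnW mM) // ltnW.
Qed.

End JRecursion.

Definition rising (R : realType) (x : R) (l : nat) : R := \prod_(i < l) (x + i%:R).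

Lemma rising_gt0 (R : realType) (x : R) (l : nat) : 0 < x -> 0 < rising x l.
Proof. by move=> x0; apply: prodr_gt0 => i _; rewrite ltr_wpDr. Qed.

Lemma risingSr (R : realType) (x : R) (l : nat) :
  rising x l.+1 = rising x l * (x + l%:R).
Proof. by rewrite /rising big_ord_recr. Qed.

Lemma risingSl (R : realType) (x : R) (l : nat) :
  rising x l.+1 = x * rising (x + 1) l.
Proof.
rewrite /rising big_ord_recl addr0; congr (_ * _); apply: eq_bigr => i _.
by rewrite /= /bump add1n -natr1 addrAC addrA.
Qed.

(** For a negative binomial variable these have the simplest moments, namely
    the powers of one constant. *)
Definition rising_ratio (R : realType) (alpha : R) (l : nat) (z : R) : R :=
  rising (alpha + z) l / rising alpha l.

Lemma mul_rising_ratio (R : realType) (alpha : R) (l : nat) (z : R) :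
  0 < alpha -> z * rising_ratio alpha l z =
  (alpha + l%:R) * (rising_ratio alpha l.+1 z - rising_ratio alpha l z).
Proof.
move=> a0; have := rising_gt0 l a0; rewrite /rising_ratio !risingSr.
have : 0 < alpha + l%:R by rewrite ltr_wpDr.
by move=> /gt_eqF/negbT ? /gt_eqF/negbT ?; field; apply/andP.
Qed.

(** Multiplying by [z] acts on the functions [rising_ratio alpha l] by
    [mul_rising_ratio], and the transposed action on coefficients is, up to
    sign, the recursion [coef_J_poly_rec]. *)
Lemma expr_rising_ratio (R : realType) (alpha z : R) (M m : nat) :
  0 < alpha -> (m <= M)%N ->
  z ^+ m = \sum_(l < m.+1)
    (-1) ^+ (l + m) * (J_poly alpha M l)`_m * rising_ratio alpha l z.
Proof.
move=> a0; elim: m => [|m IH] mM.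
  rewrite big_ord1 /J_poly big_ord0 mul1r coef_poly /= !expr0 !mul1r.
  by rewrite /rising_ratio /rising !big_ord0 divr1.
(* The common coefficient in the expansion of the left-hand side after
   mul_rising_ratio; the two sums below differ by a shift of the index. *)
pose T l := (-1) ^+ (l + m) * (alpha + l%:R) * (J_poly alpha M l)`_m.
have Tm : T m.+1 = 0 by rewrite /T coef_J_poly_eq0 ?mulr0 // ltnW.
transitivity (\sum_(l < m.+1) T l * rising_ratio alpha l.+1 z -
    \sum_(l < m.+2) T l * rising_ratio alpha l z).
  rewrite [X in _ = _ - X]big_ord_recr /= Tm mul0r addr0 -sumrB exprS IH ?(ltnW mM) // mulr_sumr.
  by apply: eq_bigr => l _; rewrite mulrCA mul_rising_ratio // /T; ring.
rewrite [X in _ - X = _]big_ord_recl [RHS]big_ord_recl /= opprD addrCA -sumrB.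
rewrite coef_J_poly_recl // {1}/T addr0; congr (_ + _).
  by rewrite !add0n exprS; ring.
apply: eq_bigr => l _; rewrite /bump /= !add1n coef_J_poly_rec // /T.
by rewrite !addSn !addnS !exprS; ring.
Qed.

(** The recursion for [f] says that [f] is negative binomial. Let [S] and [L]
    be the partial sums for [l + 1] and [l]. Multiplying the recursion by
    [rising_ratio alpha l] gives [S (N + 1) = L (N + 1) + q S N], so the limit
    of [S] is that of [L] divided by [1 - q]; the same relation with
    [S N <= S (N + 1)] bounds [S]. *)
Lemma negative_binomial_rising_moment (R : realType) (alpha q : R)
    (f : nat -> R) (l : nat) :
  0 < alpha -> 0 <= q -> q < 1 -> (forall a, 0 <= f a) ->
  (fun N => \sum_(a < N) f a) @ \oo --> (1 : R) ->
  (forall a, a.+1%:R * f a.+1 = q * (alpha + a%:R) * f a) ->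
  (fun N => \sum_(a < N) rising_ratio alpha l a%:R * f a) @ \oo
    --> ((1 - q)^-1) ^+ l.
Proof.
move=> a0 q0 q1 f0 f_sum f_rec; elim: l => [|l IH].
  rewrite expr0; apply: cvg_trans f_sum; apply: near_eq_cvg; near=> N.
  by apply: eq_bigr => a _; rewrite /rising_ratio /rising !big_ord0 divr1 mul1r.
have r0 k a : 0 <= rising_ratio alpha k a%:R.
  by rewrite divr_ge0 ?ltW // rising_gt0 // ltr_wpDr.
set Linf := _ ^+ l in IH.
pose L N := \sum_(a < N) rising_ratio alpha l a%:R * f a.
pose S N := \sum_(a < N) rising_ratio alpha l.+1 a%:R * f a.
have step a : rising_ratio alpha l.+1 a.+1%:R * f a.+1 =
    rising_ratio alpha l a.+1%:R * f a.+1 + q * (rising_ratio alpha l.+1 a%:R * f a).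
  have /(congr1 ( *%R^~ (f a.+1))) := mul_rising_ratio l a.+1%:R a0.
  rewrite mulrAC f_rec.
  have : 0 < alpha + l%:R by rewrite ltr_wpDr.
  move=> /gt_eqF/negbT al E; apply: (mulfI al); rewrite mulrDr.
  have -> : (alpha + l%:R) * (q * (rising_ratio alpha l.+1 a%:R * f a)) =
     q * (alpha + a%:R) * f a * rising_ratio alpha l a.+1%:R.
    rewrite /rising_ratio risingSl risingSr -[alpha + a.+1%:R]/_ -natr1 addrA.
    by have := rising_gt0 l a0 => /gt_eqF/negbT ?; field; apply/andP.
  by rewrite E; ring.
have Lrec N : L N.+1 = L N + rising_ratio alpha l N%:R * f N.
  by rewrite /L big_ord_recr.
have Srec N : S N.+1 = S N + rising_ratio alpha l.+1 N%:R * f N.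
  by rewrite /S big_ord_recr.
have SE N : S N.+1 = L N.+1 + q * S N.
  elim: N => [|N IHN].
    rewrite /S /L big_ord0 mulr0 addr0 !big_ord1 /rising_ratio addr0.
    by rewrite !divff // gt_eqF // rising_gt0.
  by rewrite Srec step {1}IHN (Lrec N.+1) (Srec N); ring.
have L_le N : L N <= Linf.
  rewrite -(cvg_lim _ IH) //; apply: nondecreasing_cvgn_le; last by apply/cvg_ex; exists Linf.
  by apply/nondecreasing_seqP => k; rewrite Lrec lerDl mulr_ge0.
have S_nd : nondecreasing_seq S.
  by apply/nondecreasing_seqP => k; rewrite Srec lerDl mulr_ge0.
have S_le N : S N <= Linf / (1 - q).
  rewrite ler_pdivlMr ?subr_gt0 // mulrBr mulr1 lerBlDr mulrC.
  by rewrite (le_trans (S_nd _ _ (leqnSn N))) // SE lerD2r.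
have S_cvg : cvgn S.
  by apply: nondecreasing_is_cvgn => //; exists (Linf / (1 - q)) => _ [N _ <-].
have SS : S N.+1 @[N --> \oo] --> limn S by rewrite (cvg_shiftS S).
have SS' : S N.+1 @[N --> \oo] --> Linf + q * limn S.
  under eq_fun => N do rewrite SE.
  by apply: cvgD; [rewrite (cvg_shiftS L)|exact: cvgMl_tmp].
have E := cvg_unique (@Rhausdorff R) SS SS'.
have -> : (1 - q)^-1 ^+ l.+1 = limn S; last exact: S_cvg.
have q10 : 1 - q != 0 by rewrite subr_eq0 gt_eqF.
rewrite exprS -/Linf; apply: (mulfI q10); rewrite mulrA divff // mul1r.
by rewrite mulrBl mul1r {1}E addrK.
Unshelve. all: by end_near. Qed.

(** * The law of one coordinate *)

Section Coordinate.
Context (R : realType) (n : nat) (d : measure_display) (T : measurableType d)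
  (P : probability T R) (Z : {RV P >-> n.-tuple nat}) (p : 'I_n).

Definition coord_event (a : nat) : set T := [set w | tnth (Z w) p = a].

Definition coord_prob (a : nat) : R := fine (P (coord_event a)).

Lemma measurable_coord (q : 'I_n) :
  measurable_fun [set: T] (fun w => tnth (Z w) q).
Proof. exact: (measurableT_comp (measurable_tnth q) (measurable_funPT Z)). Qed.

Lemma measurable_coord_event (q : 'I_n) (a : nat) :
  measurable [set w | tnth (Z w) q = a].
Proof.
rewrite -[X in measurable X]setTI.
have mq := measurable_coord q.
exact: (mq measurableT [set a]).
Qed.

Lemma coord_probE (a : nat) : P (coord_event a) = (coord_prob a)%:E.
Proof.
by rewrite fineK // fin_num_measure //; exact: measurable_coord_event.
Qed.

(** The sigma-algebra on tuples is generated by the coordinates, so a point is a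
    finite intersection of measurable sets. *)
Lemma measurable_RV_singleton (k : n.-tuple nat) : measurable (Z @^-1` [set k]).
Proof.
have -> : Z @^-1` [set k] = \bigcap_(q in setT) [set w | tnth (Z w) q = tnth k q].
  apply/seteqP; split => [w /= <- //|w H]; apply: eq_from_tnth => q.
  exact: H.
apply: fin_bigcap_measurable => [|q _]; first exact: finite_finset.
exact: measurable_coord_event.
Qed.

Lemma ge0_integral_coord (phi : nat -> R) : (forall a, 0 <= phi a) ->
  (\sum_(a < N) phi a * coord_prob a)%:E @[N --> \oo] -->
    (\int[P]_w (phi (tnth (Z w) p))%:E)%E.
Proof.
move=> phi0.
have cover : \bigcup_a coord_event a = setT.
  by rewrite -subTset => w _; exists (tnth (Z w) p).
rewrite -cover ge0_integral_bigcup; last 4 first.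
- by move=> a; exact: measurable_coord_event.
- rewrite cover => _ Y _; have mp := measurable_coord p.
  exact: (mp measurableT ((fun a => (phi a)%:E) @^-1` Y)).
- by move=> w _; rewrite lee_fin.
- by move=> a b _ _ [w [/= <- <-]].
have E a : (\int[P]_(w in coord_event a) (phi (tnth (Z w) p))%:E =
    (phi a * coord_prob a)%:E)%E.
  rewrite (eq_integral (cst (phi a)%:E)) => [|w]; last by rewrite inE => /= ->.
  rewrite integral_cst; last exact: measurable_coord_event.
  by rewrite EFinM -coord_probE.
rewrite (eq_eseriesr (g := fun a => (phi a * coord_prob a)%:E)) => [|a _ //].
under eq_fun => N do rewrite -sumEFin -(big_mkord xpredT
  (fun a => (phi a * coord_prob a)%:E)).
apply: is_cvg_nneseries => a _ _.
by rewrite lee_fin mulr_ge0 // fine_ge0.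
Qed.

Lemma sum_coord_prob : (fun N => \sum_(a < N) coord_prob a) @ \oo --> (1 : R).
Proof.
have := @ge0_integral_coord (fun=> 1) (fun=> ler01).
rewrite integral_cst ?mul1e ?[X in _ --> X]probability_setT //.
under eq_fun => N do under eq_bigr => a _ do rewrite mul1r.
by move=> /fine_cvgP[].
Qed.

(** The truncations exhaust the event where the coordinate is [a], and each is
    a finite union of events on which [Z] is constant. *)
Lemma cvg_level_prob (a : nat) (pmf : n.-tuple nat -> R) :
  (forall k, P (Z @^-1` [set k]) = (pmf k)%:E) ->
  (forall N, \sum_(k \in level p N a) pmf k <= coord_prob a) /\
  (fun N => \sum_(k \in level p N a) pmf k) @ \oo --> coord_prob a.
Proof.
move=> pmfE; pose E N := \bigcup_(k in level p N a) (Z @^-1` [set k]).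
have mE N : measurable (E N).
  apply: fin_bigcup_measurable => [|k _]; first exact: finite_level.
  exact: measurable_RV_singleton.
have PE N : P (E N) = (\sum_(k \in level p N a) pmf k)%:E.
  rewrite measure_fin_bigcup; last first.
  - by move=> k _; exact: measurable_RV_singleton.
  - by move=> k k' _ _ [w [/= <- <-]].
  - exact: finite_level.
  rewrite !fsbig_finite; try exact: finite_level.
  by elim/big_ind2: _ => // [? ? ? ? -> -> //|k _]; exact: pmfE.
have bigE : \bigcup_N E N = coord_event a.
  apply/seteqP; split => [w [N _ [k [_ ka] /= Zk]]|w /= wa].
    by rewrite /coord_event /= Zk.
  by exists (\sum_(i < n) tnth (Z w) i).+1 => //; exists (Z w).
have E_nd : nondecreasing_seq E.
  move=> M N MN; apply/subsetPset => w [k [k_lt ka] Zk]; exists k => //.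
  by split=> //; exact: leq_trans k_lt MN.
split=> [N|].
  rewrite -lee_fin -PE -coord_probE; apply: le_measure; rewrite ?inE //.
    exact: measurable_coord_event.
  by rewrite -bigE; exact: bigcup_sup.
have : P (E N) @[N --> \oo] --> P (coord_event a).
  rewrite -bigE; apply: nondecreasing_cvg_mu => //.
  by rewrite bigE; exact: measurable_coord_event.
rewrite coord_probE; under eq_fun => N do rewrite PE.
by move=> /fine_cvgP[].
Qed.

End Coordinate.

(** * Moments of one coordinate *)

(** The coordinate [p] of [Z] has a negative binomial distribution with
    parameter [1 - 1/c]: [resolvent_limit] is applied with [C = Abar A] to the
    truncated sums of open weights at the value [a], which are fed by the
    truncations of [P(Z_p = a)] and give back those of [P(Z_p = a + 1)]. *)
Lemma coord_prob_rec (R : realType) (alpha : R) (n : nat) (A : 'M[R]_n)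
    (d : measure_display) (T : measurableType d) (P : probability T R)
    (Z : {RV P >-> n.-tuple nat}) (p : 'I_n) (a : nat) :
  0 < alpha -> nonsingular_M_matrix A ->
  (forall k : n.-tuple nat, P (Z @^-1` [set k]) = (Z_pmf alpha A k)%:E) ->
  let c := invmx A p p * A p p in
  a.+1%:R * coord_prob Z p a.+1 = (1 - c^-1) * (alpha + a%:R) * coord_prob Z p a.
Proof.
move=> a0 MA pmfE c.
have [_ c1] := M_matrix_diag_gt0 p MA.
pose K := (\det (Abar A)) `^ alpha.
have K0 : 0 <= K by exact: powR_ge0.
have cE : invmx (Abar A) p p = c by exact: invmx_AbarE.
have B0 i j : 0 <= Bbar A i j by exact: Bbar_ge0.
have pmf_level N b : \sum_(k \in level p N b) Z_pmf alpha A k =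
    K * level_weight alpha (Bbar A) p N b.
  rewrite /level_weight !fsbig_finite; try exact: finite_level.
  rewrite mulr_sumr; apply: eq_bigr => k _.
  by rewrite /Z_pmf /weight alpha_permanent_repeat_mx mulrA.
have F_cvg b : K * level_weight alpha (Bbar A) p N b @[N --> \oo] -->
    coord_prob Z p b.
  under eq_fun => N do rewrite -pmf_level.
  by case: (cvg_level_prob p b pmfE).
have F_le N : K * level_weight alpha (Bbar A) p N a <= coord_prob Z p a.
  by rewrite -pmf_level; case: (cvg_level_prob p a pmfE).
have y0 : 0 <= alpha + a%:R by rewrite addr_ge0 // ltW.
have := @resolvent_limit R n (Abar A) p
  (fun N i => K * level_open_weight alpha (Bbar A) p N a i) _ _ _ _
  (alpha + a%:R) a.+1%:R (Abar_unit MA) _ _ y0 F_le (F_cvg a) (F_cvg a.+1).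
rewrite -BbarE // cE => H.
have {H}E : a.+1%:R * coord_prob Z p a.+1 * c =
    (c - 1) * ((alpha + a%:R) * coord_prob Z p a).
  apply: H => //.
  - move=> i j; rewrite invmx_AbarE // mulr_ge0 //; first by case: MA.
    by rewrite ltW //; case: (M_matrix_diag_gt0 j MA).
  - by move=> N i; rewrite mulr_ge0 // level_open_weight_ge0 // ltW.
  - move=> i N N' NN'; rewrite ler_wpM2l //.
    by apply: level_open_weight_nondecreasing => //; exact: ltW.
  - move=> N i; rewrite level_open_weight_rec mulrDr mulr_sumr.
    congr (_ + _); first by ring.
    by apply: eq_bigr => j _; ring.
  - by move=> N; rewrite level_open_weight_closed; ring.
have c0 : c != 0 by rewrite gt_eqF // (lt_le_trans ltr01).
by apply: (mulIf c0); rewrite E; field.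
Qed.

Theorem lemma1p7 (R : realType) (alpha : R) (n : nat) (A : 'M[R]_n)
    (d : measure_display) (T : measurableType d) (P : probability T R)
    (Z : {RV P >-> n.-tuple nat}) :
  0 < alpha ->
  nonsingular_M_matrix A ->
  (forall k : n.-tuple nat, P (Z @^-1` [set k]) = (Z_pmf alpha A k)%:E) ->
  forall (m : nat) (p : 'I_n), (1 <= m)%N ->
  ('E_P[fun w : T => (((tnth (Z w) p)%:R : R) ^+ m)%R])%E =
  (\sum_(0 <= l < m.+1) \sum_(j in J m l)
     (-1) ^+ (l + m) * (\prod_(i < l.+1) (alpha + i%:R) ^+ (j i))
       * (invmx A p p * A p p) ^+ l)%:E.
Proof.
move=> a0 MA pmfE m p _; set c := invmx A p p * A p p.
have [_ c1] := M_matrix_diag_gt0 p MA.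
have c_gt0 : 0 < c by exact: lt_le_trans ltr01 c1.
have moment l : \sum_(a < N) rising_ratio alpha l a%:R * coord_prob Z p a
    @[N --> \oo] --> c ^+ l.
  have -> : c = (1 - (1 - c^-1))^-1 by rewrite subKr invrK.
  apply: negative_binomial_rising_moment => //.
  - by rewrite subr_ge0 invf_le1.
  - by rewrite ltrBlDr ltrDl invr_gt0.
  - by move=> a; rewrite fine_ge0.
  - exact: sum_coord_prob.
  - by move=> a; exact: coord_prob_rec.
have sumE N : \sum_(a < N) a%:R ^+ m * coord_prob Z p a =
    \sum_(l < m.+1) (-1) ^+ (l + m) * (J_poly alpha m l)`_m *
      \sum_(a < N) rising_ratio alpha l a%:R * coord_prob Z p a.
  under [RHS]eq_bigr => l _ do rewrite mulr_sumr.
  rewrite exchange_big /=; apply: eq_bigr => a _.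
  rewrite (expr_rising_ratio a%:R a0 (leqnn m)) mulr_suml.
  by apply: eq_bigr => l _; rewrite [RHS]mulrA.
rewrite unlock.
have expect := @ge0_integral_coord _ _ _ _ P Z p (fun a => a%:R ^+ m)
  (fun a => exprn_ge0 m (ler0n R a)).
apply: (cvg_unique (@ereal_hausdorff R) expect).
apply: cvg_EFin; first by near=> N.
rewrite /comp /=.
have -> : \sum_(0 <= l < m.+1) \sum_(j in J m l)
     (-1) ^+ (l + m) * (\prod_(i < l.+1) (alpha + i%:R) ^+ (j i)) * c ^+ l =
  \sum_(l < m.+1) (-1) ^+ (l + m) * (J_poly alpha m l)`_m * c ^+ l.
  rewrite big_mkord; apply: eq_bigr => l _.
  by rewrite -mulr_suml -mulr_sumr -J_sumE.
under eq_fun => N do rewrite sumE.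
apply: cvg_big => [|l _]; first exact: add_continuous.
exact: cvgMl_tmp.
Unshelve. all: by end_near. Qed.
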